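(* Let $X$ be a real normed space and let $C\subseteq X$ be a convex cone with a finite basis $\{e_1,\dots,e_n\}$. If $\varphi:C\rightarrow c(C)$ is a linear correspondence, then $$\mathfrak{h}_1(M_{\varphi},\{\mathbb{I}\})=\sup\{\mathfrak{h}(\varphi(x),\{x\}):x\in C,\ \|x\|=1\}.$$
   Context: A subset $C$ of a real normed space $X$ is a cone if $tC\subseteq C$ for every $t>0$. A linearly independent set $E$ is a basis of the cone $C$ if $C$ is exactly the set of all finite combinations $\lambda_1e_1+\dots+\lambda_ne_n$ with $e_i\in E$ and $\lambda_i\ge 0$. $c(C)$ is the set of all nonempty compact subsets of $C$; $\varphi:C\to c(C)$ denotes a correspondence (set-valued map) with values $\varphi(x)\in c(C)$. It is linear if $\varphi(x+y)=\varphi(x)+\varphi(y)$ and $\varphi(\lambda x)=\lambda\varphi(x)$ for all $x,y\in C$, $\lambda>0$. The linear isomorphism $l:C-C\to\mathbb{R}^n$ is $l\left(\sum_{j=1}^n\lambda_je_j\right)=(\lambda_1,\dots,\lambda_n)^T$, and $M_\varphi:=l(\varphi(e_1))\times\dots\times l(\varphi(e_n))$ is regarded as the set of all real $n\times n$ matrices whose $j$-th column lies in $l(\varphi(e_j))$ for each $j$. $\mathfrak{h}$ is the Hausdorff metric on nonempty compact sets, $\mathfrak{h}(A,B)=\max\{\sup_{a\in A}d(a,B),\sup_{b\in B}d(b,A)\}$, for the norm of $X$. The space of real $n\times n$ matrices carries the norm $$\|A\|=\sup\left\{\left\|\sum_{i=1}^n\left(\sum_{j=1}^n\lambda_ja_{ij}\right)e_i\right\|:\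 \sum_{j=1}^n\lambda_je_j\in C,\ \left\|\sum_{j=1}^n\lambda_je_j\right\|=1\right\},\quad A=[a_{ij}],$$ $\mathfrak{h}_1$ is the Hausdorff metric derived from this matrix norm, and $\mathbb{I}$ is the unit (identity) matrix. *)

(* Defs.v *)
From HB Require Import structures.
From mathcomp Require Import all_boot all_order all_algebra finmap.
From mathcomp Require Import all_classical all_reals all_analysis.

Set Implicit Arguments.
Unset Strict Implicit.
Unset Printing Implicit Defensive.

Import Order.TTheory GRing.Theory Num.Theory.
Import numFieldNormedType.Exports.

Local Open Scope classical_set_scope.
Local Open Scope ring_scope.

Section cones.
Context {R : realType} {X : normedModType R}.

Definition is_cone (C : set X) : Prop :=
  forall t : R, 0 < t -> ( *:%R t) @` C `<=` C.

Definition linearly_independent (E : set X) : Prop :=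
  forall (s : {fset X}) (lambda : X -> R), [set` s] `<=` E ->
    \sum_(v <- s) lambda v *: v = 0 -> forall v, v \in s -> lambda v = 0.

Definition nonneg_combinations (E : set X) : set X :=
  [set x | exists (s : {fset X}) (lambda : X -> R),
    [/\ [set` s] `<=` E, (forall v, v \in s -> 0 <= lambda v) &
        x = \sum_(v <- s) lambda v *: v]].

Definition cone_basis (C E : set X) : Prop :=
  linearly_independent E /\ C = nonneg_combinations E.

Definition compact_subsets (C : set X) : set (set X) :=
  [set K | [/\ K !=set0, compact K & K `<=` C]].

(* A correspondence C -> c(C) is encoded by a total function on X of which
   only the values on C matter. *)
Definition correspondence (C : set X) (phi : X -> set X) : Prop :=
  forall x, C x -> compact_subsets C (phi x).

Definition linear_correspondence (C : set X) (phi : X -> set X) : Prop :=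
  (forall x y, C x -> C y ->
     phi (x + y) = [set u + v | u in phi x & v in phi y]) /\
  (forall (lambda : R) x, C x -> 0 < lambda ->
     phi (lambda *: x) = ( *:%R lambda) @` phi x).

Definition lincomb n (e : 'I_n -> X) (lambda : 'cV[R]_n) : X :=
  \sum_(j < n) lambda j 0 *: e j.

(* The isomorphism l : C - C -> R^n, i.e. the inverse of [lincomb e]; its value
   outside the span of the (independent) family e is irrelevant. *)
Definition coord_iso n (e : 'I_n -> X) (x : X) : 'cV[R]_n :=
  xget 0 [set lambda | x = lincomb e lambda].

Definition corr_matrices n (e : 'I_n -> X) (phi : X -> set X) : set 'M[R]_n :=
  [set A | forall j, (coord_iso e @` phi (e j)) (col j A)].

(* The supremum is that of a bounded set, since X is only involved through the
   finite-dimensional span of e; the empty supremum (n = 0) is 0. The norm is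
   not the one MathComp-Analysis attaches to matrices. *)
Definition cone_mxnorm n (C : set X) (e : 'I_n -> X) (A : 'M[R]_n) : R :=
  sup [set `|\sum_(i < n) (\sum_(j < n) lambda j 0 * A i j) *: e i|
      | lambda in [set lambda : 'cV[R]_n |
          C (lincomb e lambda) /\ `|lincomb e lambda| = 1]].

End cones.

Section hausdorff_metric.
Context {R : realType} {T : Type}.
Variable d : T -> T -> R.

Definition dist_to_set (a : T) (B : set T) : R := inf [set d a b | b in B].

Definition hausdorff_dist (A B : set T) : R :=
  Num.max (sup [set dist_to_set a B | a in A])
          (sup [set dist_to_set b A | b in B]).

End hausdorff_metric.

Definition hausdorff {R : realType} {X : normedModType R} : set X -> set X -> R :=
  hausdorff_dist (fun x y => `|x - y|).

Definition hausdorff1 {R : realType} {X : normedModType R} n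
    (C : set X) (e : 'I_n -> X) : set 'M[R]_n -> set 'M[R]_n -> R :=
  hausdorff_dist (fun A B => cone_mxnorm C e (A - B)).

(* Main.v *)
Require Import Defs.
From HB Require Import structures.
From mathcomp Require Import all_boot all_order all_algebra finmap.
From mathcomp Require Import all_classical all_reals all_analysis.

Import Order.TTheory GRing.Theory Num.Theory.
Import numFieldNormedType.Exports.

Local Open Scope classical_set_scope.
Local Open Scope ring_scope.

(** Write a point of the cone as x = lincomb e lambda, with coordinates
    lambda >= 0, and let a matrix A act by x |-> lincomb e (A *m lambda).
    Linearity of phi gives phi x = sum_j lambda_j phi (e_j), a Minkowski sum.
    A matrix of M_phi is a choice of one point u_j of phi (e_j) for each j, and
    it sends x to sum_j lambda_j u_j; hence phi x is the set of all A x with A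
    in M_phi ([corr_lincomb]). Coordinates equal to 0 need phi 0 = {0}, which
    holds because phi 0 is a bounded set invariant under positive scalings
    ([linear_correspondence0]).

    The Hausdorff distance from a bounded nonempty set to a point is the
    largest distance to that point ([hausdorff_dist_set1]). So the left-hand
    side is the supremum over A, and the right-hand side the supremum over
    unit vectors x, of the supremum of |A x - x| over the other variable, and
    the theorem says that the two suprema commute ([sup_sup_swap]).

    The suprema are real numbers, with a conventional value on unbounded sets,
    so a uniform bound on |A x - x| is needed. On the unit sphere the
    coordinates of x are bounded, because all norms on the span of e are
    equivalent ([lincomb_norm_lower_bound]), and the columns of A range over
    bounded sets because the phi (e_j) are compact
    ([corr_displacement_bounded]). *)

(** * Suprema of bounded families and distances to a point *)

Section suprema.
Context {R : realType}.

(** The bound M has to be nonnegative because the supremum of the empty family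
    is 0. *)
Lemma sup_image_le {I : Type} (f : I -> R) (A : set I) (M : R) :
  0 <= M -> (forall i, A i -> f i <= M) -> sup [set f i | i in A] <= M.
Proof.
move=> M0 fM; have [->|/set0P[i Ai]] := eqVneq A set0; first by rewrite image_set0 sup0.
by apply: ge_sup => [|_ [j Aj <-]]; [exists (f i), i|exact: fM].
Qed.

Lemma le_sup_image {I : Type} (f : I -> R) (A : set I) (M : R) (i : I) :
  (forall i, A i -> f i <= M) -> A i -> f i <= sup [set f i | i in A].
Proof.
move=> fM Ai; apply: ub_le_sup; last by exists i.
by exists M => _ [j Aj <-]; exact: fM.
Qed.

(** An unbounded set conforms to this too, because its supremum is 0 by
    convention. *)
Lemma sup_image_ge0 {I : Type} (f : I -> R) (A : set I) :
  (forall i, A i -> 0 <= f i) -> 0 <= sup [set f i | i in A].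
Proof.
move=> f0; have [[[_ [i Ai _]] [M fM]]|/sup_out ->//] :=
  pselect (has_sup [set f i | i in A]).
apply: le_trans (f0 i Ai) _; apply: ub_le_sup; last by exists i.
by exists M.
Qed.

Lemma sup_sup_le {I J : Type} (f : I -> J -> R) (A : set I) (B : set J) (M : R) :
  (forall i j, A i -> B j -> 0 <= f i j <= M) ->
  sup [set sup [set f i j | j in B] | i in A] <=
  sup [set sup [set f i j | i in A] | j in B].
Proof.
move=> fM.
have f0 i j : A i -> B j -> 0 <= f i j by move=> Ai Bj; case/andP: (fM i j Ai Bj).
have fle i j : A i -> B j -> f i j <= M by move=> Ai Bj; case/andP: (fM i j Ai Bj).
have sup0 : 0 <= sup [set sup [set f i j | i in A] | j in B].
  by apply: sup_image_ge0 => j Bj; apply: sup_image_ge0 => i Ai; exact: f0.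
apply: sup_image_le => // i Ai; apply: sup_image_le => // j Bj.
apply: le_trans (le_sup_image (fun i => f i j) A M i _ Ai) _.
  by move=> k Ak; exact: fle.
apply: (le_sup_image (fun j => sup [set f i j | i in A]) B M) => // k Bk.
apply: sup_image_le => [|l Al]; last exact: fle.
exact: le_trans (f0 _ _ Ai Bk) (fle _ _ Ai Bk).
Qed.

(** Empty suprema are 0, so both sides are 0 when A or B is empty; nonnegativity
    of f lets one argument cover this case. *)
Lemma sup_sup_swap {I J : Type} (f : I -> J -> R) (A : set I) (B : set J) (M : R) :
  (forall i j, A i -> B j -> 0 <= f i j <= M) ->
  sup [set sup [set f i j | j in B] | i in A] =
  sup [set sup [set f i j | i in A] | j in B].
Proof.
move=> fM; apply/le_anti; rewrite (sup_sup_le _ _ _ M)//=.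
by apply: (sup_sup_le (fun j i => f i j) B A M) => j i Bj Ai; exact: fM.
Qed.

(** The other half of the Hausdorff distance, from b to the set A, is an infimum
    of the same numbers d a b and is therefore dominated by their supremum. *)
Lemma hausdorff_dist_set1 {T : Type} (d : T -> T -> R) (A : set T) (b : T)
    (M : R) :
  (forall x y, 0 <= d x y) -> (forall x y, d x y = d y x) ->
  A !=set0 -> (forall a, A a -> d a b <= M) ->
  hausdorff_dist d A [set b] = sup [set d a b | a in A].
Proof.
move=> d0 dC [a Aa] dM; rewrite /hausdorff_dist /dist_to_set image_set1 sup1.
under eq_imagel => x _ do rewrite image_set1 inf1.
apply/max_idPl; apply: le_trans (le_sup_image (d^~ b) A M a dM Aa).
rewrite dC; apply: ge_inf; last by exists a.
by exists 0 => _ [x _ <-].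
Qed.

End suprema.

(** * Coordinates with respect to a finite independent family *)

Section coordinates.
Context {R : realType} {X : normedModType R} {n : nat} (e : 'I_n -> X).
Implicit Types (lambda : 'cV[R]_n) (A : 'M[R]_n).

Lemma lincombZ (a : R) lambda : lincomb e (a *: lambda) = a *: lincomb e lambda.
Proof.
by rewrite /lincomb scaler_sumr; apply: eq_bigr => j _; rewrite mxE scalerA.
Qed.

Lemma lincombB lambda mu :
  lincomb e (lambda - mu) = lincomb e lambda - lincomb e mu.
Proof.
rewrite /lincomb -sumrB; apply: eq_bigr => j _.
by rewrite !mxE scalerBl.
Qed.

Lemma lincomb0 : lincomb e 0 = 0.
Proof. by rewrite /lincomb big1// => j _; rewrite mxE scale0r. Qed.

Lemma lincomb_delta j : lincomb e (delta_mx j 0) = e j.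
Proof.
rewrite /lincomb (bigD1 j)//= big1 ?addr0 => [|i /negbTE ij].
  by rewrite mxE !eqxx scale1r.
by rewrite mxE ij scale0r.
Qed.

(** The columns of A are the coordinates of the images of the vectors of e. *)
Lemma lincomb_mulmx A lambda :
  lincomb e (A *m lambda) = \sum_j lambda j 0 *: lincomb e (col j A).
Proof.
rewrite /lincomb.
under eq_bigr => i _ do rewrite mxE scaler_suml.
rewrite exchange_big; apply: eq_bigr => j _; rewrite scaler_sumr.
by apply: eq_bigr => i _; rewrite mxE scalerA mulrC.
Qed.

Lemma sum_range (f : X -> X) : injective e ->
  \sum_(v <- [fset e j | j in 'I_n]%fset) f v = \sum_j f (e j).
Proof.
move=> inj_e; rewrite big_imfset/=; last by move=> i j _ _; exact: inj_e.
by rewrite big_enum.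
Qed.

(** Linear independence of the set range e speaks of coefficients indexed by
    vectors; injectivity of e allows indexing them by 'I_n. *)
Lemma lincomb_eq0 : injective e -> linearly_independent (range e) ->
  forall lambda, lincomb e lambda = 0 -> lambda = 0.
Proof.
move=> inj_e indep lambda lambda0; apply/colP => j; rewrite mxE.
(* The sum has the single term k = j when v = e j. *)
pose f v : R := \sum_(k | e k == v) lambda k 0.
have fE k : f (e k) = lambda k 0.
  by rewrite /f (eq_bigl (pred1 k)) ?big_pred1_eq// => i; rewrite /= (inj_eq inj_e).
rewrite -fE; apply: (indep [fset e j | j in 'I_n]%fset f).
- by move=> v/= /imfsetP[k _ ->]; exists k.
- rewrite (sum_range (fun v => f v *: v))// -[RHS]lambda0.
  by apply: eq_bigr => k _; rewrite fE.
- by apply/imfsetP; exists j.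
Qed.

Lemma lincomb_inj : injective e -> linearly_independent (range e) ->
  injective (lincomb e).
Proof.
move=> inj_e indep lambda mu eq_lm; apply/eqP; rewrite -subr_eq0; apply/eqP.
by apply: lincomb_eq0 => //; rewrite lincombB eq_lm subrr.
Qed.

Lemma lincombK : injective e -> linearly_independent (range e) ->
  cancel (lincomb e) (coord_iso e).
Proof.
move=> inj_e indep lambda; rewrite /coord_iso.
case: xgetP => [mu _ /= eq_lm|/(_ lambda)]; last by move=> /(_ erefl).
exact/(lincomb_inj inj_e indep)/esym.
Qed.

Lemma nonneg_combinations_range : injective e ->
  nonneg_combinations (range e) =
  lincomb e @` [set lambda : 'cV[R]_n | forall j, 0 <= lambda j 0].
Proof.
move=> inj_e; apply/seteqP; split=> [_ [s [f [se f0 ->]]]|_ [lambda l0 <-]].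
  exists (\col_j if e j \in s then f (e j) else 0) => [j|] /=.
    by rewrite mxE; case: ifP => // /f0.
  transitivity (\sum_j (if e j \in s then f (e j) else 0) *: e j).
    by apply: eq_bigr => j _; rewrite mxE.
  rewrite -(sum_range (fun v => (if v \in s then f v else 0) *: v))//.
  rewrite -(@big_fset_incl _ _ _ _ s)/=.
  - by apply: eq_big_seq => v ->.
  - by apply/fsubsetP => v /se[j _ <-]; apply/imfsetP; exists j.
  - by move=> v _ /negbTE ->; rewrite scale0r.
exists [fset e j | j in 'I_n]%fset, (fun v => \sum_(k | e k == v) lambda k 0).
split => [v/= /imfsetP[k _ ->]|v _|]; first by exists k.
  by apply: sumr_ge0.
rewrite (sum_range (fun v => _ *: v))//; apply: eq_bigr => k _.
by rewrite (eq_bigl (pred1 k)) ?big_pred1_eq// => i; rewrite /= (inj_eq inj_e).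
Qed.

(** Equivalence of norms in finite dimension: on the compact unit sphere of the
    coordinate space the continuous function lambda |-> |lincomb e lambda|
    attains its minimum, which is positive by independence; homogeneity extends
    the bound to all vectors. Row vectors are used because
    [bounded_closed_compact] and [EVT_min_rV] are about them. *)
Lemma lincomb_norm_lower_bound : (forall lambda, lincomb e lambda = 0 -> lambda = 0) ->
  exists2 c : R, 0 < c & forall lambda j, c * `|lambda j 0| <= `|lincomb e lambda|.
Proof.
move=> inj.
pose f (v : 'rV[R]_n) := `|lincomb e v^T|.
suff [c c0 cf] : exists2 c, 0 < c & forall v : 'rV[R]_n, c * `|v| <= f v.
  exists c => // lambda j; have := cf lambda^T; rewrite /f trmxK; apply: le_trans.
  rewrite ler_pM2l// [leRHS]mx_normrE.
  by have := @le_bigmax _ _ _ 0 (fun i : 'I_1 * 'I_n => `|lambda^T i.1 i.2|) (0, j);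
    rewrite mxE.
pose S := [set v : 'rV[R]_n | `|v| = 1].
have fZ a v : f (a *: v) = `|a| * f v by rewrite /f linearZ lincombZ normrZ.
have normalise v : v != 0 -> S (`|v|^-1 *: v).
  by move=> v0; rewrite /S/= normrZ normfV normr_id mulVf// normr_eq0.
have f_ge c : 0 < c -> (forall v, S v -> c <= f v) ->
    exists2 c, 0 < c & forall v : 'rV[R]_n, c * `|v| <= f v.
  move=> c0 cf; exists c => // v; have [->|v0] := eqVneq v 0.
    by rewrite normr0 mulr0 normr_ge0.
  have := cf _ (normalise _ v0).
  by rewrite fZ normfV normr_id ler_pdivlMl ?normr_gt0// mulrC.
(* When n = 0 the sphere is empty and any constant works. *)
have [[v0 Sv0]|S0] := pselect (S !=set0); last first.
  by apply: (f_ge 1) => // v Sv; case: S0; exists v.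
have cS : compact S.
  apply: bounded_closed_compact.
    by exists 1; split => // M M1 v /= ->; exact: ltW.
  apply: (@preimage_closed _ _ (fun v : 'rV[R]_n => `|v|) [set 1]).
    by move=> v _; exact: norm_continuous.
  exact: closed_eq.
have cf : continuous f.
  move=> v; apply: (@continuous_comp _ _ _ (fun w => lincomb e w^T) (fun x => `|x|));
    last exact: norm_continuous.
  have -> : (fun v : 'rV[R]_n => lincomb e v^T) = fun v => \sum_j v 0 j *: e j.
    by apply/funext => w; apply: eq_bigr => j _; rewrite mxE.
  apply: (continuous_big add_continuous) => j _ w.
  exact: (cvgZr_tmp (@coord_continuous R 1 n 0 j w)).
have [v Sv fmin] := EVT_min_rV (ex_intro _ v0 Sv0) cS (continuous_subspaceT cf).
apply: (f_ge (f v)).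
  rewrite /f normr_gt0; apply/eqP => /inj/(congr1 trmx); rewrite trmxK trmx0 => v_eq0.
  by move: Sv; rewrite v_eq0 inE /S/= normr0 => /esym/eqP; rewrite oner_eq0.
by move=> w Sw; apply: fmin; rewrite inE.
Qed.

End coordinates.

(** * Linear correspondences on a cone with a finite basis *)

Section linear_correspondences.
Context {R : realType} {X : normedModType R} {n : nat}.
Variables (C : set X) (e : 'I_n -> X) (phi : X -> set X).
Hypothesis inj_e : injective e.
Hypothesis basis_e : cone_basis C (range e).
Hypothesis phi_corr : correspondence C phi.
Hypothesis phi_lin : linear_correspondence C phi.
Implicit Types (lambda : 'cV[R]_n) (A : 'M[R]_n).

Lemma cone_lincomb x :
  C x <-> exists2 lambda : 'cV[R]_n, forall j, 0 <= lambda j 0 & lincomb e lambda = x.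
Proof.
by have [_ ->] := basis_e; rewrite nonneg_combinations_range.
Qed.

Lemma cone_lincomb_ge0 lambda : C (lincomb e lambda) -> forall j, 0 <= lambda j 0.
Proof.
move=> /cone_lincomb[mu mu0].
by move=> /(lincomb_inj _ inj_e (proj1 basis_e)) <-.
Qed.

Lemma cone0 : C 0.
Proof.
apply/cone_lincomb; exists 0 => [j|]; first by rewrite mxE.
exact: lincomb0.
Qed.

Lemma coneD x y : C x -> C y -> C (x + y).
Proof.
move=> /cone_lincomb[lambda l0 <-] /cone_lincomb[mu m0 <-].
apply/cone_lincomb; exists (lambda + mu) => [j|]; first by rewrite mxE addr_ge0.
rewrite /lincomb -big_split; apply: eq_bigr => j _.
by rewrite mxE scalerDl.
Qed.

Lemma coneZ (a : R) x : 0 <= a -> C x -> C (a *: x).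
Proof.
move=> a0 /cone_lincomb[lambda l0 <-].
apply/cone_lincomb; exists (a *: lambda) => [j|]; first by rewrite mxE mulr_ge0.
by rewrite lincombZ.
Qed.

Lemma cone_basis_vector j : C (e j).
Proof.
apply/cone_lincomb; exists (delta_mx j 0) => [i|]; first by rewrite mxE.
exact: lincomb_delta.
Qed.

Lemma corr_nonempty x : C x -> phi x !=set0.
Proof. by move=> /phi_corr[]. Qed.

Lemma corr_bounded x : C x -> exists M, forall u, phi x u -> `|u| <= M.
Proof.
move=> /phi_corr[_ /compact_bounded[M [_ phiM]] _].
by exists (M + 1); apply: phiM; rewrite ltrDl.
Qed.

(** Positive homogeneity makes phi 0 invariant under positive scalings, and a
    bounded set with this property contains no nonzero vector. *)
Lemma linear_correspondence0 : phi 0 = [set 0].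
Proof.
have [M phiM] := corr_bounded 0 cone0.
have phi0 u : phi 0 u -> u = 0.
  move=> phiu; apply/eqP; rewrite -normr_le0 leNgt; apply/negP => u0.
  have M0 : 0 <= M := le_trans (normr_ge0 u) (phiM u phiu).
  (* The multiple of u of norm M + 1 contradicts the bound M on phi 0. *)
  pose a := (M + 1) / `|u|.
  have a0 : 0 < a by rewrite divr_gt0// ltr_wpDl.
  have : phi 0 (a *: u).
    by rewrite -(scaler0 _ a) phi_lin.2//; [exists u|exact: cone0].
  move=> /phiM; rewrite normrZ gtr0_norm// divfK ?gt_eqF//.
  by rewrite leNgt ltrDl ltr01.
apply/seteqP; split => [u /phi0 //|_ ->].
by have [u phiu] := corr_nonempty 0 cone0; move: (phiu); rewrite (phi0 u phiu).
Qed.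

Lemma linear_correspondenceZ (a : R) x : 0 <= a -> C x ->
  phi (a *: x) = ( *:%R a) @` phi x.
Proof.
rewrite le_eqVlt => /predU1P[<- Cx|a0 Cx]; last exact: phi_lin.2.
rewrite scale0r linear_correspondence0; apply/seteqP; split => [_ ->|_ [u _ <-]].
  by have [u phiu] := corr_nonempty x Cx; exists u => //; rewrite scale0r.
by rewrite scale0r.
Qed.

(** The values phi (e j) need not be convex, so a Minkowski sum in which the
    same j occurs twice would require two independent choices in phi (e j);
    hence the sum runs over a duplicate-free list of indices. *)
Lemma linear_correspondence_sum lambda (r : seq 'I_n) :
  (forall j, 0 <= lambda j 0) -> uniq r ->
  phi (\sum_(j <- r) lambda j 0 *: e j) =
  [set \sum_(j <- r) lambda j 0 *: u j |
     u in [set u : 'I_n -> X | forall j, phi (e j) (u j)]].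
Proof.
move=> l0; elim: r => [_|k r IHr /= /andP[kr uniq_r]].
  rewrite big_nil linear_correspondence0; apply/seteqP; split => [_ ->|_ [u _ <-]].
    have /choice[u phiu] j := corr_nonempty (e j) (cone_basis_vector j).
    by exists u => //; rewrite big_nil.
  by rewrite big_nil.
have Csum : C (\sum_(j <- r) lambda j 0 *: e j).
  elim/big_ind: _ => [|x y|j _]; [exact: cone0|exact: coneD|].
  exact: coneZ (cone_basis_vector j).
have Ck : C (lambda k 0 *: e k) by exact: coneZ (cone_basis_vector k).
rewrite big_cons phi_lin.1// IHr// linear_correspondenceZ//; last first.
  exact: cone_basis_vector.
apply/seteqP; split => [_ [_ [w phiw <-] [_ [u phiu <-] <-]]|_ [u phiu <-]].
  exists (fun j => if j == k then w else u j) => [j|] /=.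
    by case: eqP => [->|].
  rewrite big_cons eqxx; congr (_ + _); apply: eq_big_seq => j jr.
  by case: eqP jr kr => // -> ->.
exists (lambda k 0 *: u k); first by exists (u k).
exists (\sum_(j <- r) lambda j 0 *: u j); first by exists u.
by rewrite big_cons.
Qed.

(** Since the values of phi lie in the cone, hence in the span of e, the
    coordinate isomorphism can be traded for its inverse. *)
Lemma corr_matricesP A :
  corr_matrices e phi A <-> forall j, phi (e j) (lincomb e (col j A)).
Proof.
split=> MA j; last first.
  exists (lincomb e (col j A)) => //.
  by rewrite lincombK//; exact: (proj1 basis_e).
have [u phiu <-] := MA j.
have [_ _ /(_ u phiu)/cone_lincomb[mu _ mu_u]] := phi_corr _ (cone_basis_vector j).
by rewrite -mu_u lincombK ?mu_u//; exact: (proj1 basis_e).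
Qed.

(** A choice of one point in each phi (e j) is the same thing as a matrix of
    M_phi, through the columns of the matrix. *)
Lemma corr_lincomb lambda : C (lincomb e lambda) ->
  phi (lincomb e lambda) =
  [set lincomb e (A *m lambda) | A in corr_matrices e phi].
Proof.
move=> Cl; rewrite linear_correspondence_sum; last 2 first.
- exact: cone_lincomb_ge0.
- exact: index_enum_uniq.
apply/seteqP; split => [_ [u phiu <-]|_ [A MA <-]]; last first.
  by exists (fun j => lincomb e (col j A)); [exact/corr_matricesP|rewrite lincomb_mulmx].
have /choice[c c_u] j : exists lambda, lincomb e lambda = u j.
  have [_ _ /(_ _ (phiu j))/cone_lincomb[mu _ mu_u]] := phi_corr _ (cone_basis_vector j).
  by exists mu.
have colE j : col j (\matrix_(i, k) c k i 0) = c j.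
  by apply/colP => i; rewrite !mxE.
exists (\matrix_(i, k) c k i 0).
  by apply/corr_matricesP => j; rewrite colE c_u.
by rewrite lincomb_mulmx; apply: eq_bigr => j _; rewrite colE c_u.
Qed.

Lemma corr_matrices_nonempty : corr_matrices e phi !=set0.
Proof.
have C0 : C (lincomb e 0) by rewrite lincomb0; exact: cone0.
by have := corr_nonempty _ C0; rewrite corr_lincomb// => -[_ [A MA _]]; exists A.
Qed.

(** The vector A x - x is the combination, with the coordinates of x, of the
    vectors u_j - e_j with u_j in phi (e j). Both the coordinates of a unit
    vector x and these vectors are bounded independently of A and x. *)
Lemma corr_displacement_bounded :
  exists M, forall A lambda, corr_matrices e phi A ->
    C (lincomb e lambda) /\ `|lincomb e lambda| = 1 ->
    `|lincomb e ((A - 1%:M) *m lambda)| <= M.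
Proof.
have [c c0 cP] := lincomb_norm_lower_bound e (lincomb_eq0 e inj_e (proj1 basis_e)).
have /choice[N phiN] j := corr_bounded (e j) (cone_basis_vector j).
exists (\sum_j c^-1 * (N j + `|e j|)) => A lambda /corr_matricesP MA [_ norm1].
rewrite lincomb_mulmx; apply: le_trans (ler_norm_sum _ _ _) _.
apply: ler_sum => j _; rewrite normrZ; apply: ler_pM => //.
  by rewrite -[c^-1]mulr1 ler_pdivlMl// -norm1.
have -> : col j (A - 1%:M) = col j A - delta_mx j 0.
  by apply/colP => i; rewrite !mxE eqxx andbT.
rewrite lincombB lincomb_delta; apply: le_trans (ler_normB _ _) _.
by rewrite lerD//; exact: phiN.
Qed.

End linear_correspondences.

(** * The distance from the matrices of a correspondence to the identity *)

Lemma cone_mxnormE {R : realType} {X : normedModType R} {n : nat} (C : set X)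
    (e : 'I_n -> X) (A : 'M[R]_n) :
  cone_mxnorm C e A = sup [set `|lincomb e (A *m lambda)| | lambda in
    [set lambda : 'cV[R]_n | C (lincomb e lambda) /\ `|lincomb e lambda| = 1]].
Proof.
rewrite /cone_mxnorm; congr sup; apply: eq_imagel => lambda _.
congr `|_|; apply: eq_bigr => i _; congr (_ *: _).
by rewrite mxE; apply: eq_bigr => j _; rewrite mulrC.
Qed.

Theorem lemma3 (R : realType) (X : normedModType R) (C : set X) (n : nat)
    (e : 'I_n -> X) (phi : X -> set X)
    (coneC : is_cone C) (convexC : convex_set C)
    (inj_e : injective e) (basis_e : cone_basis C (range e))
    (phi_corr : correspondence C phi)
    (phi_lin : linear_correspondence C phi) :
  hausdorff1 C e (corr_matrices e phi) [set 1%:M] =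
  sup [set hausdorff (phi x) [set x] | x in [set x | C x /\ `|x| = 1]].
Proof.
have [M boundM] := corr_displacement_bounded C e phi inj_e basis_e phi_corr.
pose L := [set lambda : 'cV[R]_n | C (lincomb e lambda) /\ `|lincomb e lambda| = 1].
pose f (A : 'M[R]_n) (lambda : 'cV[R]_n) := `|lincomb e ((A - 1%:M) *m lambda)|.
have fM A lambda : corr_matrices e phi A -> L lambda -> 0 <= f A lambda <= M.
  by move=> MA Ll; rewrite normr_ge0 boundM.
have normM A : cone_mxnorm C e (A - 1%:M) = sup [set f A lambda | lambda in L].
  exact: cone_mxnormE.
have -> : hausdorff1 C e (corr_matrices e phi) [set 1%:M] =
    sup [set sup [set f A lambda | lambda in L] | A in corr_matrices e phi].
  (* M itself may be negative when no x in C has norm 1. *)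
  rewrite /hausdorff1 (hausdorff_dist_set1 _ _ _ `|M|).
  - by congr sup; apply: eq_imagel => A _; rewrite normM.
  - by move=> A B; rewrite cone_mxnormE; apply: sup_image_ge0.
  - move=> A B; rewrite !cone_mxnormE; congr sup; apply: eq_imagel => lambda _.
    by rewrite -opprB mulNmx -scaleN1r lincombZ scaleN1r normrN.
  - exact: corr_matrices_nonempty inj_e basis_e phi_corr phi_lin.
  - move=> A MA; rewrite normM; apply: sup_image_le => // lambda Ll.
    by apply: le_trans (ler_norm M); case/andP: (fM A lambda MA Ll).
have LE : [set x | C x /\ `|x| = 1] = lincomb e @` L.
  apply/seteqP; split => [x [Cx x1]|_ [lambda Ll <-] //].
  have [lambda _ lx] := (cone_lincomb C e inj_e basis_e x).1 Cx.
  by exists lambda; rewrite // /L/= lx.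
rewrite (sup_sup_swap f _ _ M)// LE image_comp; congr sup.
apply: eq_imagel => lambda Ll /=; have [Cl l1] := Ll.
have fE A : `|lincomb e (A *m lambda) - lincomb e lambda| = f A lambda.
  by rewrite /f mulmxBl mul1mx lincombB.
have phiE := corr_lincomb C e phi inj_e basis_e phi_corr phi_lin lambda Cl.
rewrite /hausdorff (hausdorff_dist_set1 _ _ _ M).
- by rewrite phiE image_comp; congr sup; apply: eq_imagel => A _ /=.
- by [].
- by move=> x y; exact: distrC.
- by have [] := phi_corr _ Cl.
- by rewrite phiE => _ [A MA <-]; rewrite fE; case/andP: (fM A lambda MA Ll).
Qed.
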